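(* There are exactly seven entailment relations in $\mathsf{G}^2_{(\rightarrow,-\!<)}$ that are induced by \emph{point-generated} filters on $[0,1]^{\Join}$.
   Context: $\mathsf{G}^2_{(\rightarrow,-\!<)}$: formulas built from variables with $\neg$, ${\sim},\triangle,\wedge,\vee,\rightarrow$ and co-implication $-\!<$. Write $a\rightarrow_{\mathsf{G}} b=1$ if $a\leq b$ else $b$, and $a-\!<_{\mathsf{G}} b=0$ if $a\leq b$ else $a$. A valuation is a pair $v=\langle v_1,v_2\rangle$ of maps from variables to $[0,1]$ extended by: $v_1(\neg\phi)=v_2(\phi)$, $v_2(\neg\phi)=v_1(\phi)$; $v_1(\triangle\phi)=1$ iff $v_1(\phi)=1$ (else $0$), $v_2(\triangle\phi)=1$ iff $v_2(\phi)>0$ (else $0$); $v_1({\sim}\phi)=1$ iff $v_1(\phi)=0$ (else $0$), $v_2({\sim}\phi)=1-\!<_{\mathsf{G}}v_2(\phi)$; $v_1(\wedge)=\min$, $v_2(\wedge)=\max$; $v_1(\vee)=\max$, $v_2(\vee)=\min$; $v_1(\phi\rightarrow\chi)=v_1(\phi)\rightarrow_{\mathsf{G}}v_1(\chi)$, $v_2(\phi\rightarrow\chi)=v_2(\chi)-\!<_{\mathsf{G}}v_2(\phi)$; $v_1(\phi-\!<\chi)=v_1(\phi)-\!<_{\mathsf{G}}v_1(\chi)$, $v_2(\phi-\!<\chi)=v_2(\chi)\rightarrow_{\mathsf{G}}v_2(\phi)$. $[0,1]^{\Join}=[0,1]^2$ with truth order $\langle x,y\rangle\leq\langle x',y'\rangle$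 iff $x\leq x'$ and $y\geq y'$. For $\langle x,y\rangle\neq\langle0,1\rangle$, the point-generated filter is $\langle x,y\rangle^\uparrow=\{\langle x',y'\rangle\mid x'\geq x,\,y'\leq y\}$. With $v[\Gamma]=\langle\inf_{\phi\in\Gamma}v_1(\phi),\sup_{\phi\in\Gamma}v_2(\phi)\rangle$, $\Gamma\models^\mathcal{D}\chi$ iff for every $v$, $v[\Gamma]\in\mathcal{D}$ implies $v(\chi)\in\mathcal{D}$. *)

(* Defs.v *)
(* MathComp world (MathComp-Analysis classical sets and reals). *)
From mathcomp Require Import all_boot all_order all_algebra.
From mathcomp Require Import boolp classical_sets functions cardinality reals.

Set Implicit Arguments.
Unset Strict Implicit.
Unset Printing Implicit Defensive.

Import Order.TTheory GRing.Theory Num.Theory.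
Local Open Scope classical_set_scope.
Local Open Scope ring_scope.

(* Propositional variables form a countably infinite set. [Neg] is the
   paraconsistent negation, [Tilde] the Goedel negation, and
   [Coimp phi chi] is phi -< chi. *)
Inductive formula : Type :=
| Var of nat
| Neg of formula
| Tilde of formula
| Delta of formula
| And of formula & formula
| Or of formula & formula
| Imp of formula & formula
| Coimp of formula & formula.

Section GoedelSquare.
Variable R : realType.

Definition goedel_imp (a b : R) : R := if a <= b then 1 else b.
Definition goedel_coimp (a b : R) : R := if a <= b then 0 else a.

Definition in01 (a : R) : Prop := 0 <= a /\ a <= 1.

Record valuation : Type := Valuation {
  var1 : nat -> R;
  var2 : nat -> R;
  var1_in01 : forall i, in01 (var1 i);
  var2_in01 : forall i, in01 (var2 i)
}.

Fixpoint eval1 (v : valuation) (phi : formula) : R :=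
  match phi with
  | Var i => var1 v i
  | Neg a => eval2 v a
  | Tilde a => if eval1 v a == 0 then 1 else 0
  | Delta a => if eval1 v a == 1 then 1 else 0
  | And a b => Num.min (eval1 v a) (eval1 v b)
  | Or a b => Num.max (eval1 v a) (eval1 v b)
  | Imp a b => goedel_imp (eval1 v a) (eval1 v b)
  | Coimp a b => goedel_coimp (eval1 v a) (eval1 v b)
  end
with eval2 (v : valuation) (phi : formula) : R :=
  match phi with
  | Var i => var2 v i
  | Neg a => eval1 v a
  | Tilde a => goedel_coimp 1 (eval2 v a)
  | Delta a => if 0 < eval2 v a then 1 else 0
  | And a b => Num.max (eval2 v a) (eval2 v b)
  | Or a b => Num.min (eval2 v a) (eval2 v b)
  | Imp a b => goedel_coimp (eval2 v b) (eval2 v a)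
  | Coimp a b => goedel_imp (eval2 v b) (eval2 v a)
  end.

Definition eval (v : valuation) (phi : formula) : R * R :=
  (eval1 v phi, eval2 v phi).

(* The carrier [0,1]^2 of the bilattice and its truth order. *)
Definition square : set (R * R) := [set p | in01 p.1 /\ in01 p.2].

Definition truth_le (p q : R * R) : Prop := p.1 <= q.1 /\ q.2 <= p.2.

Definition point_filter (p : R * R) : set (R * R) :=
  [set q | square q /\ truth_le p q].

Definition point_generated : set (set (R * R)) :=
  [set point_filter p | p in [set p | square p /\ p <> (0, 1)]].

(* Infima and suprema are those of the complete lattice [0,1]: adjoining the
   top (bottom) element changes nothing except that the empty infimum
   (supremum) is 1 (0). *)
Definition inf01 (A : set R) : R := inf (1 |` A).
Definition sup01 (A : set R) : R := sup (0 |` A).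

Definition eval_set (v : valuation) (Gamma : set formula) : R * R :=
  (inf01 [set eval1 v phi | phi in Gamma],
   sup01 [set eval2 v phi | phi in Gamma]).

Definition entails (D : set (R * R)) (Gamma : set formula) (chi : formula)
    : Prop :=
  forall v : valuation, D (eval_set v Gamma) -> D (eval v chi).

End GoedelSquare.

(* Main.v *)
Require Import Defs.
From mathcomp Require Import all_boot all_order all_algebra.
From mathcomp Require Import boolp classical_sets functions cardinality reals.
From mathcomp Require Import lra.

(** Call a formula designated at [(x, y)] when [x <= v1] and [v2 <= y]; infima
    and suprema play no role, since [v[Gamma]] lies in the filter iff every
    member of [Gamma] is designated.  All connectives commute with strictly
    increasing maps of [[0,1]] fixing the end points, and with the conflation
    [(a, b) |-> (1 - b, 1 - a)].  So only the relative order of [0, x, y, 1]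
    matters, up to identifying [(x, y)] with [(1 - y, 1 - x)]: this leaves the
    points [(1,0), (1,1), (c,1), (1,c), (c,c), (c,d), (d,c)] with
    [0 < c < d < 1].  With [~] for [Neg], they are told apart by which of
    the sets [{p /\ ~p}], [{p /\ ~p, q /\ ~q, p -< q}], [{p, q, p -< q}],
    [{triangle (p /\ ~p)}] are explosive, and by whether [p] entails
    [triangle p]. *)

Section PointGenerated.
Import Order.TTheory GRing.Theory Num.Theory.
Local Open Scope classical_set_scope.
Local Open Scope ring_scope.
Variable R : realType.
Implicit Types (v : valuation R) (p q : R * R) (phi chi : formula).

(** * Designation, and entailment in terms of it *)

Lemma goedel_imp_in01 (a b : R) : in01 b -> in01 (goedel_imp a b).
Proof. by rewrite /goedel_imp; case: ifP => // _ _; split; lra. Qed.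

Lemma goedel_coimp_in01 (a b : R) : in01 a -> in01 (goedel_coimp a b).
Proof. by rewrite /goedel_coimp; case: ifP => // _ _; split; lra. Qed.

Lemma eval_in01 v phi : in01 (eval1 v phi) /\ in01 (eval2 v phi).
Proof.
have in01_bool (b : bool) : in01 (if b then 1 else 0 : R).
  by case: b; split; lra.
have in01_1 : in01 (1 : R) by split; lra.
elim: phi => [i|a [a1 a2]|a [a1 a2]|a [a1 a2]|a [a1 a2] b [b1 b2]
  |a [a1 a2] b [b1 b2]|a [a1 a2] b [b1 b2]|a [a1 a2] b [b1 b2]] /=.
- by split; [exact: var1_in01 | exact: var2_in01].
- by [].
- by split; [exact: in01_bool | exact: goedel_coimp_in01].
- by split; exact: in01_bool.
- by rewrite minElt maxElt; split; case: ifP.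
- by rewrite minElt maxElt; split; case: ifP.
- by split; [exact: goedel_imp_in01 | exact: goedel_coimp_in01].
- by split; [exact: goedel_coimp_in01 | exact: goedel_imp_in01].
Qed.

Definition designated p v phi : bool :=
  (p.1 <= eval1 v phi) && (eval2 v phi <= p.2).

(** The adjoined [1] makes the set nonempty and [A01] bounds it below by [0], so [inf] is a true
    infimum; since [x <= 1], the adjoined element adds no constraint. *)
Lemma le_inf01 (A : set R) (x : R) : A `<=` @in01 R -> x <= 1 ->
  x <= inf01 A <-> forall a, A a -> x <= a.
Proof.
move=> A01 x1; split=> [xA a Aa|xA].
  apply: (le_trans xA); apply: ge_inf; last by right.
  by exists 0 => b [->|/A01 []]; rewrite ?ler01.
by apply: lb_le_inf; [exists 1; left | move=> b [->|/xA]].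
Qed.

Lemma sup01_le (A : set R) (y : R) : A `<=` @in01 R -> 0 <= y ->
  sup01 A <= y <-> forall a, A a -> a <= y.
Proof.
move=> A01 y0; split=> [Ay a Aa|Ay].
  apply: le_trans Ay; apply: ub_le_sup; last by right.
  by exists 1 => b [->|/A01 []]; rewrite ?ler01.
by apply: ge_sup; [exists 0; left | move=> b [->|/Ay]].
Qed.

Lemma point_filter_eval p v phi :
  point_filter p (eval v phi) <-> designated p v phi.
Proof.
rewrite /point_filter /truth_le /designated /=.
have [a b] := eval_in01 v phi; split=> [[_ [-> ->]] //|/andP[? ?]].
by split.
Qed.

Lemma point_filter_eval_set p v Gamma : square p ->
  point_filter p (eval_set v Gamma) <->
  forall phi, Gamma phi -> designated p v phi.
Proof.
move=> [[x0 x1] [y0 y1]].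
have E1 : [set eval1 v phi | phi in Gamma] `<=` @in01 R.
  by move=> _ [phi _ <-]; case: (eval_in01 v phi).
have E2 : [set eval2 v phi | phi in Gamma] `<=` @in01 R.
  by move=> _ [phi _ <-]; case: (eval_in01 v phi).
have inf_in01 : in01 (inf01 [set eval1 v phi | phi in Gamma]).
  split; first by apply/(le_inf01 _ _ E1) => // a /E1[].
  apply: ge_inf; last by left.
  by exists 0 => b [->|/E1 []]; rewrite ?ler01.
have sup_in01 : in01 (sup01 [set eval2 v phi | phi in Gamma]).
  split; last by apply/(sup01_le _ _ E2) => // a /E2[].
  apply: ub_le_sup; last by left.
  by exists 1 => b [->|/E2 []]; rewrite ?ler01.
rewrite /point_filter /truth_le /=; split.
  move=> [_ [/(le_inf01 _ _ E1 x1) A /(sup01_le _ _ E2 y0) B]] phi Gphi.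
  by rewrite /designated A ?B //; exists phi.
move=> G; do 2!split=> //.
  by apply/(le_inf01 _ _ E1 x1) => _ [phi /G/andP[? _] <-].
by apply/(sup01_le _ _ E2 y0) => _ [phi /G/andP[_ ?] <-].
Qed.

Lemma entails_point_filter p Gamma chi : square p ->
  entails (point_filter p) Gamma chi <->
  forall v, (forall phi, Gamma phi -> designated p v phi) ->
    designated p v chi.
Proof.
move=> sp; split=> H v.
  by move/(point_filter_eval_set _ _ _ sp)/H/point_filter_eval.
by move/(point_filter_eval_set _ _ _ sp)/H/point_filter_eval.
Qed.

Lemma entails1 p phi chi : square p ->
  entails (point_filter p) [set phi] chi <->
  forall v, designated p v phi -> designated p v chi.
Proof.
move=> sp; rewrite entails_point_filter //; split=> H v Hv; apply: H.
  by move=> _ ->.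
exact: Hv.
Qed.

(** * Invariance under order embeddings and conflation *)

Lemma entails_transfer p q (f : valuation R -> valuation R) :
  square p -> square q ->
  (forall v phi, designated q (f v) phi = designated p v phi) ->
  forall Gamma chi, entails (point_filter q) Gamma chi ->
    entails (point_filter p) Gamma chi.
Proof.
move=> sp sq fE Gamma chi /(entails_point_filter _ _ _ sq) H.
(* A countermodel [v] at [p] would be carried to a countermodel [f v] at [q]. *)
apply/(entails_point_filter _ _ _ sp) => v Gv; rewrite -fE; apply: H => phi.
by rewrite fE; exact: Gv.
Qed.

(** Monotonicity is asked on all of [R], so that [le_mono] gives order reflection without membership
    side conditions. *)
Record embedding01 (h : R -> R) : Prop := Embedding01 {
  embedding0 : h 0 = 0;
  embedding1 : h 1 = 1;
  embedding_lt : {homo h : a b / a < b}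
}.

Lemma embedding_in01 h a : embedding01 h -> in01 a -> in01 (h a).
Proof.
move=> [h0 h1 hlt] [a0 a1].
by split; [rewrite -h0|rewrite -h1]; rewrite (le_mono hlt).
Qed.

Definition map_val {h} (hE : embedding01 h) v : valuation R :=
  Valuation (fun i => embedding_in01 h _ hE (var1_in01 v i))
            (fun i => embedding_in01 h _ hE (var2_in01 v i)).

(** Every connective returns [0], [1] or one of the argument values, selected by comparing these
    with each other and with [0] and [1]; [h] preserves the constants and all the comparisons. *)
Lemma eval_map_val h (hE : embedding01 h) v phi :
  eval1 (map_val hE v) phi = h (eval1 v phi) /\
  eval2 (map_val hE v) phi = h (eval2 v phi).
Proof.
have [h0 h1 hlt] := hE; have hle := le_mono hlt.
have hltE := leW_mono hle.
have heq a b : (h a == h b) = (a == b) by rewrite !eq_le !hle.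
have hpos a : (0 < h a) = (0 < a) by rewrite -{1}h0 hltE.
have hzero a : (h a == 0) = (a == 0) by rewrite -{1}h0 heq.
have hone a : (h a == 1) = (a == 1) by rewrite -{1}h1 heq.
have hone_le a : (1 <= h a) = (1 <= a) by rewrite -{1}h1 hle.
elim: phi => [i|a [a1 a2]|a [a1 a2]|a [a1 a2]|a [a1 a2] b [b1 b2]
  |a [a1 a2] b [b1 b2]|a [a1 a2] b [b1 b2]|a [a1 a2] b [b1 b2]] //=;
  rewrite ?a1 ?a2 ?b1 ?b2 /goedel_imp /goedel_coimp ?minElt ?maxElt;
  rewrite ?hzero ?hone ?hpos ?hone_le ?hle ?hltE; split; case: ifP;
  by rewrite ?h0 ?h1.
Qed.

Lemma entails_embedding {h} : embedding01 h -> forall p, square p ->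
  forall Gamma chi, entails (point_filter (h p.1, h p.2)) Gamma chi ->
    entails (point_filter p) Gamma chi.
Proof.
move=> hE p [p1 p2]; apply: (entails_transfer _ _ (map_val hE)) => //.
  by split; exact: embedding_in01.
move=> v phi; rewrite /designated; have [-> ->] := eval_map_val _ hE v phi.
by rewrite /= !(le_mono (embedding_lt _ hE)).
Qed.

Lemma in01_compl (a : R) : in01 a -> in01 (1 - a).
Proof. by move=> [? ?]; split; lra. Qed.

Definition conflate v : valuation R :=
  Valuation (fun i => in01_compl _ (var2_in01 v i))
            (fun i => in01_compl _ (var1_in01 v i)).

(** The two clauses of each connective are dual to each other under the order reversal
    [a |-> 1 - a], which exchanges [0] with [1], min with max and [goedel_imp] with
    [goedel_coimp]. *)
Lemma eval_conflate v phi :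
  eval1 (conflate v) phi = 1 - eval2 v phi /\
  eval2 (conflate v) phi = 1 - eval1 v phi.
Proof.
elim: phi => [i|a [a1 a2]|a [a1 a2]|a [a1 a2]|a [a1 a2] b [b1 b2]
  |a [a1 a2] b [b1 b2]|a [a1 a2] b [b1 b2]|a [a1 a2] b [b1 b2]] //=;
  rewrite ?a1 ?a2 ?b1 ?b2 /goedel_imp /goedel_coimp ?minElt ?maxElt;
  have := eval_in01 v a; rewrite /in01;
  set x1 := eval1 v a; set x2 := eval2 v a => -[[? ?] [? ?]];
  rewrite ?eq_le.
all: split; repeat case: ifP; try (move=> *; lra).
Qed.

Lemma entails_conflation p : square p ->
  entails (point_filter p) = entails (point_filter (1 - p.2, 1 - p.1)).
Proof.
have half q : square q -> forall Gamma chi,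
    entails (point_filter (1 - q.2, 1 - q.1)) Gamma chi ->
    entails (point_filter q) Gamma chi.
  move=> [q1 q2]; apply: (entails_transfer _ _ conflate) => //.
    by split; exact: in01_compl.
  move=> v phi; rewrite /designated /=; have [-> ->] := eval_conflate v phi.
  by rewrite !lerD2l !lerN2 andbC.
move=> sp; have sp' : square (1 - p.2, 1 - p.1).
  by case: sp => p1 p2; split; exact: in01_compl.
apply/funext => Gamma; apply/funext => chi; apply/propext; split; last exact: half.
(* Conflation is an involution, so [half] at the conflated point is the converse. *)
by move=> H; apply: half => //=; rewrite !subKr -surjective_pairing.
Qed.

(** The piecewise linear map through [(0, 0)], [(s, t)], [(s', t')] and [(1, 1)], with positive
    slopes [k1], [k2], [k3]. *)
Lemma two_point_embedding (s s' t t' : R) :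
  0 < s -> s < s' -> s' < 1 -> 0 < t -> t < t' -> t' < 1 ->
  exists2 h, embedding01 h & h s = t /\ h s' = t'.
Proof.
move=> s0 ss' s1 t0 tt' t1.
pose k1 := t / s; pose k2 := (t' - t) / (s' - s); pose k3 := (1 - t') / (1 - s').
have k1E : k1 * s = t by rewrite divfK //; lra.
have k2E : k2 * (s' - s) = t' - t by rewrite divfK //; lra.
have k3E : k3 * (1 - s') = 1 - t' by rewrite divfK //; lra.
have k1_gt0 : 0 < k1 by rewrite divr_gt0 //; lra.
have k2_gt0 : 0 < k2 by rewrite divr_gt0 //; lra.
have k3_gt0 : 0 < k3 by rewrite divr_gt0 //; lra.
exists (fun a => if a <= s then k1 * a else
  if a <= s' then t + k2 * (a - s) else t' + k3 * (a - s')).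
  split=> [||a b ab]; first by rewrite mulr0 ltW.
    by case: ifP => ?; [lra|]; case: ifP => ?; lra.
  have m1 : k1 * a < k1 * b by rewrite ltr_pM2l.
  have m2 : k2 * a < k2 * b by rewrite ltr_pM2l.
  have m3 : k3 * a < k3 * b by rewrite ltr_pM2l.
  case: (leP a s) => as_; case: (leP b s) => bs //; first last.
  - by case: (leP a s') => ?; case: (leP b s') => ?; nra.
  - lra.
  - have : k1 * a <= k1 * s by rewrite ler_pM2l.
    have : 0 < k2 * (b - s) by rewrite mulr_gt0 // subr_gt0.
    by case: (leP b s') => ? ? ?; nra.
rewrite lexx [s' <= s]leNgt ss' /= lexx; split; lra.
Qed.

(** Each inclusion of entailments comes from one embedding; [h] and [g] run in opposite
    directions. *)
Lemma entails_same_order (s s' t t' : R) :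
  0 < s -> s < s' -> s' < 1 -> 0 < t -> t < t' -> t' < 1 ->
  [/\ entails (point_filter (s, 1)) = entails (point_filter (t, 1)),
      entails (point_filter (1, s)) = entails (point_filter (1, t)),
      entails (point_filter (s, s)) = entails (point_filter (t, t)),
      entails (point_filter (s, s')) = entails (point_filter (t, t')) &
      entails (point_filter (s', s)) = entails (point_filter (t', t))].
Proof.
move=> s0 ss' s1 t0 tt' t1.
have [h hE [hs hs']] := two_point_embedding _ _ _ _ s0 ss' s1 t0 tt' t1.
have [g gE [gt gt']] := two_point_embedding _ _ _ _ t0 tt' t1 s0 ss' s1.
have key (p q : R * R) : square p -> square q ->
    (h p.1, h p.2) = q -> (g q.1, g q.2) = p ->
    entails (point_filter p) = entails (point_filter q).
  move=> sp sq hpq gqp.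
  apply/funext => Gamma; apply/funext => chi; apply/propext; split=> H.
    by apply: (entails_embedding gE) => //; rewrite gqp.
  by apply: (entails_embedding hE) => //; rewrite hpq.
have h1 := embedding1 _ hE; have g1 := embedding1 _ gE.
by split; apply: key; rewrite /= ?hs ?hs' ?h1 ?gt ?gt' ?g1 //;
  split; split; rewrite /=; lra.
Qed.

(** * Formulas that separate the relations *)

Let P := Var 0.
Let Q := Var 1.
(** Its value is always [(0, 1)], which lies in no filter generated by another point; entailing it
    therefore expresses explosiveness. *)
Let Bot := Coimp P P.

Lemma designated_Bot p v : square p -> p <> (0, 1) -> designated p v Bot = false.
Proof.
case: p => x y [[/= x0 x1] [y0 y1]] pN.
rewrite /designated /= /goedel_coimp /goedel_imp !lexx.
apply/negP => /andP[x_le0 y_ge1]; apply: pN.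
by congr pair; apply/eqP; rewrite eq_le ?x0 ?y1 ?x_le0 ?y_ge1.
Qed.

Lemma designated_And p v phi chi :
  designated p v (And phi chi) = designated p v phi && designated p v chi.
Proof. by rewrite /designated /= le_min ge_max andbACA. Qed.

Lemma entails_Bot p phi : square p -> p <> (0, 1) ->
  entails (point_filter p) [set phi] Bot <-> forall v, ~~ designated p v phi.
Proof.
move=> sp pN; rewrite entails1 //; split=> H v.
  by apply/negP => /H; rewrite designated_Bot.
by rewrite (negbTE (H v)).
Qed.

Lemma valuation2 (a b c d : R) : in01 a -> in01 b -> in01 c -> in01 d ->
  exists v, [/\ var1 v 0 = a, var2 v 0 = b, var1 v 1 = c & var2 v 1 = d].
Proof.
move=> ha hb hc hd.
have h1 i : in01 (if i is 0 then a else c) by case: i.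
have h2 i : in01 (if i is 0 then b else d) by case: i.
by exists (Valuation h1 h2).
Qed.

Let Contr phi := And phi (Neg phi).

(** Designating [Contr P] at [(x, y)] means that both coordinates of [P] lie in the interval from
    [x] to [y]. *)
Lemma explosive_contradiction p : square p -> p <> (0, 1) ->
  entails (point_filter p) [set Contr P] Bot <-> p.2 < p.1.
Proof.
case: p => x y sp pN; rewrite entails_Bot //= {pN}.
case: sp => /= x01 y01; split=> [H|yx v].
  rewrite ltNge; apply/negP => xy.
  have [v [v1 v2 _ _]] := valuation2 x x x x x01 x01 x01 x01.
  by have /negP[] := H v; rewrite designated_And /designated /= v1 v2 lexx xy.
by rewrite designated_And /designated /=; apply/negP => /andP[/andP[? ?] /andP[? ?]]; lra.
Qed.

(** All four coordinates of [P] and [Q] lie between [x] and [y]. If that interval has at most one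
    point they coincide, and [Coimp P Q] takes the value [(0, 1)]. *)
Lemma explosive_contradictions_Coimp p : square p -> p <> (0, 1) ->
  entails (point_filter p) [set And (And (Contr P) (Contr Q)) (Coimp P Q)] Bot
  <-> p.2 <= p.1.
Proof.
case: p => x y sp pN; rewrite entails_Bot //= {pN}.
case: sp => /= x01 y01; split=> [H|yx v].
  rewrite leNgt; apply/negP => xy.
  (* With [P] at [(y, x)] and [Q] at [(x, y)], [Coimp P Q] keeps the value [(y, x)] of [P]. *)
  have [v [v1 v2 v3 v4]] := valuation2 y x x y y01 x01 x01 y01.
  have /negP[] := H v; rewrite !designated_And /designated /=.
  rewrite /goedel_imp /goedel_coimp v1 v2 v3 v4.
  by rewrite [y <= x]leNgt xy /= !lexx (ltW xy).
rewrite !designated_And /designated /= /goedel_imp /goedel_coimp.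
have [? ?] := x01; have [? ?] := y01.
apply/negP => /andP[/andP[/andP[/andP[? ?] /andP[? ?]] /andP[/andP[? ?] /andP[? ?]]]].
case: (leP (var1 v 0) (var1 v 1)) => ?; last lra.
case: (leP (var2 v 1) (var2 v 0)) => ?; last lra.
move=> /andP[? ?]; lra.
Qed.

(** If [x = 1], designation forces equal first coordinates of [P] and [Q], and that of [Coimp P Q]
    drops to [0]; dually for [y = 0] and the second coordinates. *)
Lemma explosive_Coimp p : square p -> p <> (0, 1) ->
  entails (point_filter p) [set And (And P Q) (Coimp P Q)] Bot
  <-> (p.1 == 1) || (p.2 == 0).
Proof.
rewrite -(rwP orP) -!(rwP eqP).
case: p => x y sp pN; rewrite entails_Bot //= {pN}.
case: sp => /= x01 y01; have [x0 x1] := x01; have [y0 y1] := y01.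
split=> [H|xy v].
  have [|x_ge1] := ltP x 1 => [x_lt1|]; last by left; lra.
  have [|y_le0] := ltP 0 y => [y_gt0|]; last by right; lra.
  have in0 : in01 (0 : R) by split; lra.
  have in1 : in01 (1 : R) by split; lra.
  (* [P] is the top and [Q] the generator, strictly below it in both coordinates, so [Coimp P Q] is
     again the top. *)
  have [v [v1 v2 v3 v4]] := valuation2 1 0 x y in1 in0 x01 y01.
  have /negP[] := H v; rewrite !designated_And /designated /=.
  rewrite /goedel_imp /goedel_coimp v1 v2 v3 v4.
  by rewrite [1 <= x]leNgt x_lt1 [y <= 0]leNgt y_gt0 /= !lexx x1 y0.
have [? ?] := var1_in01 v 0; have [? ?] := var1_in01 v 1.
have [? ?] := var2_in01 v 0; have [? ?] := var2_in01 v 1.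
rewrite !designated_And /designated /= /goedel_imp /goedel_coimp.
apply/negP => /andP[/andP[/andP[? ?] /andP[? ?]]].
case: (leP (var1 v 0) (var1 v 1)) => ?; case: (leP (var2 v 1) (var2 v 0)) => ?;
  move=> /andP[? ?]; case: xy => ?; lra.
Qed.

(** The coordinates of the formula are [0] or [1]. For [0 < x] and [y < 1] only [(1, 0)] would be
    designated, which needs the min of the coordinates of [P] to be [1] and their max [0]. Otherwise
    [P] at [(0, 0)] or [(1, 1)] is a model. *)
Lemma explosive_Delta_contradiction p : square p -> p <> (0, 1) ->
  entails (point_filter p) [set Delta (Contr P)] Bot
  <-> (0 < p.1) && (p.2 < 1).
Proof.
rewrite -(rwP andP).
case: p => x y sp pN; rewrite entails_Bot //= {pN}.
case: sp => /= x01 y01; have [x0 x1] := x01; have [y0 y1] := y01.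
have const_val (a : R) : in01 a -> exists v, var1 v 0 = a /\ var2 v 0 = a.
  by move=> ha; have [v [? ? _ _]] := valuation2 a a a a ha ha ha ha; exists v.
split=> [H|[x_gt0 y_lt1] v].
  split; rewrite ltNge; apply/negP => ?.
    have [|v [v1 v2]] := const_val 0; first by split; lra.
    have /negP[] := H v; rewrite /designated /= v1 v2 minxx maxxx ltxx y0 andbT.
    by case: ifP => _; lra.
  have [|v [v1 v2]] := const_val 1; first by split; lra.
  have /negP[] := H v; rewrite /designated /= v1 v2 minxx maxxx eqxx x1 /=.
  by rewrite ltr01; lra.
have [? ?] := var1_in01 v 0; have [? ?] := var2_in01 v 0.
rewrite /designated /= minElt lt_max; apply/negP.
case: (ltP (var1 v 0) (var2 v 0)) => ?; case: eqP => ?;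
  case: (ltP 0 (var1 v 0)) => ?; case: (ltP 0 (var2 v 0)) => ? /= /andP[? ?]; lra.
Qed.

(** The critical value of [P] is the generator itself: [Delta] lowers [x] to [0] unless [x = 1], and
    raises [y] to [1] unless [y = 0]. *)
Lemma entails_Delta p : square p ->
  entails (point_filter p) [set P] (Delta P) <->
  ((p.1 == 0) || (p.1 == 1)) && ((p.2 == 0) || (p.2 == 1)).
Proof.
rewrite -(rwP andP) -!(rwP orP) -!(rwP eqP).
case: p => x y sp; rewrite entails1 //=.
case: sp => /= x01 y01; have [x0 x1] := x01; have [y0 y1] := y01.
split=> [H|[hx hy] v].
  have [v [v1 v2 _ _]] := valuation2 x y x y x01 y01 x01 y01.
  have := H v; rewrite /designated /= v1 v2 !lexx => /(_ isT)/andP[].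
  case: eqP => hx; case: (ltP 0 y) => hy ? ?.
  - by split; right; lra.
  - by split; [right|left]; lra.
  - by split; [left|right]; lra.
  - by split; left; lra.
have [? ?] := var1_in01 v 0; have [? ?] := var2_in01 v 0.
rewrite /designated /= => /andP[? ?].
case: eqP => ?; case: (ltP 0 (var2 v 0)) => ?; apply/andP; split;
  case: hx => ?; case: hy => ?; lra.
Qed.

(** * Signatures and the seven representatives *)

Definition signature p : seq bool :=
  [:: p.2 < p.1; p.2 <= p.1; (p.1 == 1) || (p.2 == 0); (0 < p.1) && (p.2 < 1);
      ((p.1 == 0) || (p.1 == 1)) && ((p.2 == 0) || (p.2 == 1))].

(** The entries are, in order, the criteria of the five separating lemmas, so each is determined by
    the entailment relation. *)
Lemma entails_signature p q : square p -> p <> (0, 1) -> square q ->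
  q <> (0, 1) -> entails (point_filter p) = entails (point_filter q) ->
  signature p = signature q.
Proof.
move=> sp pN sq qN E.
have same (X : Prop) (b c : bool) : (X <-> b) -> (X <-> c) -> b = c.
  by move=> Xb Xc; apply/idP/idP => [/Xb/Xc|/Xc/Xb].
congr [:: _; _; _; _; _].
- apply: same (explosive_contradiction _ sp pN) _.
  by rewrite E; exact: explosive_contradiction.
- apply: same (explosive_contradictions_Coimp _ sp pN) _.
  by rewrite E; exact: explosive_contradictions_Coimp.
- apply: same (explosive_Coimp _ sp pN) _.
  by rewrite E; exact: explosive_Coimp.
- apply: same (explosive_Delta_contradiction _ sp pN) _.
  by rewrite E; exact: explosive_Delta_contradiction.
- apply: same (entails_Delta _ sp) _.
  by rewrite E; exact: entails_Delta.
Qed.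

Let c : R := 3^-1.
Let d : R := 2^-1.

Definition representatives : seq (R * R) :=
  [:: (1, 0); (1, 1); (c, 1); (1, c); (c, c); (c, d); (d, c)].

Let c_gt0 : 0 < c. Proof. by rewrite /c; lra. Qed.
Let cd : c < d. Proof. by rewrite /c /d; lra. Qed.
Let d_lt1 : d < 1. Proof. by rewrite /d; lra. Qed.

Lemma representatives_admissible p : p \in representatives ->
  square p /\ p <> (0, 1).
Proof.
have := (c_gt0, cd, d_lt1) => -[[? ?] ?].
rewrite !inE; do ![case/orP]; move=> /eqP ->;
  (split; first by split; split => /=; lra); case=> *; lra.
Qed.

(** In the order of the list, with T for true and F for false: TTTTT, FTTFT, FFFFF, TTTTF, FTFTF,
    FFFTF, TTFTF. *)
Lemma uniq_signatures : uniq (map signature representatives).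
Proof.
have [[c0 c_d] d1] := (c_gt0, cd, d_lt1).
have c1 : c < 1 := lt_trans c_d d1.
rewrite /signature /= !ltxx !lexx !eqxx ltr01 ler01 c1 c0 c_d (ltW c_d).
rewrite (ltW c1) (lt_gtF c1) (lt_gtF c_d) (lt_geF c1).
rewrite (lt_geF c_d) (lt_eqF c1) (gt_eqF c0) (lt_eqF d1).
by rewrite (gt_eqF (lt_trans c0 c_d)) (lt_trans c0 c_d) d1 oner_eq0.
Qed.

(** * Reduction of every generator to a representative *)

Lemma entails_representative p : square p -> p <> (0, 1) ->
  exists2 q, q \in representatives &
    entails (point_filter p) = entails (point_filter q).
Proof.
move=> sp pN.
suff [i hi ->] : exists2 i, (i < 7)%N & entails (point_filter p) =
    entails (point_filter (nth (1, 0) representatives i)).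
  by exists (nth (1, 0) representatives i); rewrite ?mem_nth.
have one_point (s : R) : 0 < s -> s < 1 ->
    [/\ entails (point_filter (s, 1)) = entails (point_filter (c, 1)),
        entails (point_filter (1, s)) = entails (point_filter (1, c)) &
        entails (point_filter (s, s)) = entails (point_filter (c, c))].
  move=> s0 s1.
  (* The midpoint of [s] and [1] supplies the second, larger point that the lemma requires. *)
  by have [||||||] := entails_same_order s ((1 + s) / 2) c d; rewrite ?c_gt0 //; lra.
case: p sp pN => x y sp pN; have [[/= x0 x1] [/= y0 y1]] := sp.
have [x_gt0|x_le0] := ltP 0 x; last first.
  have xE : x = 0 by lra.
  have y_lt1 : y < 1.
    by rewrite ltNge; apply/negP => ?; apply: pN; congr pair; lra.
  (* Conflation moves [(0, y)] to [(1 - y, 1)], of the type of [(1, 1)] or [(c, 1)]. *)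
  rewrite entails_conflation //= xE subr0.
  have [y_gt0|y_le0] := ltP 0 y; last first.
    by exists 1%N => //; have -> : 1 - y = 1 by lra.
  by exists 2%N => //; have [||->] := one_point (1 - y); rewrite ?subr_gt0 //; lra.
have [y_lt1|y_ge1] := ltP y 1; last first.
  have yE : y = 1 by lra.
  have [x_lt1|x_ge1] := ltP x 1; last first.
    by exists 1%N; rewrite //= yE; have -> : x = 1 by lra.
  by exists 2%N => //; rewrite yE; have [] := one_point x.
have [x_lt1|x_ge1] := ltP x 1; last first.
  have xE : x = 1 by lra.
  rewrite xE; have [y_gt0|y_le0] := ltP 0 y; last first.
    by exists 0%N => //; have -> : y = 0 by lra.
  by exists 3%N => //; have [] := one_point y.
have [y_gt0|y_le0] := ltP 0 y; last first.
  (* Conflation moves [(x, 0)] to [(1, 1 - x)], of the type of [(1, c)]. *)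
  rewrite entails_conflation //=; have -> : y = 0 by lra.
  rewrite subr0; exists 3%N => //.
  by have [||_ ->] := one_point (1 - x); rewrite ?subr_gt0 //; lra.
(* Both coordinates are now strictly between [0] and [1], and only their mutual order remains. *)
have [xy|yx|xy] := ltgtP x y.
- exists 5%N => //.
  by have [] := entails_same_order x y c d x_gt0 xy y_lt1 c_gt0 cd d_lt1.
- exists 6%N => //.
  by have [] := entails_same_order y x c d y_gt0 yx x_lt1 c_gt0 cd d_lt1.
- by exists 4%N => //; rewrite -xy; have [] := one_point x.
Qed.

End PointGenerated.

(** * Counting the relations *)

Local Open Scope classical_set_scope.
Local Open Scope card_scope.

Theorem theorem9 (R : realType) :
  [set @entails R D | D in @point_generated R] #= `I_7.
Proof.
pose r := nth (1, 0)%R (representatives R).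
have r_in i : (i < 7)%N -> r i \in representatives R by move=> ?; exact: mem_nth.
have -> : [set @entails R D | D in @point_generated R] =
    [set entails (point_filter (r i)) | i in `I_7].
  apply/seteqP; split=> [_ [_ [p [sp pN] <-] <-]|_ [i /= /r_in ri <-]].
    have [q q_in ->] := entails_representative _ _ sp pN.
    exists (index q (representatives R)); last by rewrite /r nth_index.
    by move: q_in; rewrite -index_mem.
  exists (point_filter (r i)) => //; exists (r i) => //.
  exact: representatives_admissible.
(* Equal relations have equal signatures, and the seven signatures are distinct, so the indexing is
   injective. *)
apply: inj_card_eq => i j; rewrite !inE /= => hi hj E.
have [si iN] := representatives_admissible _ _ (r_in _ hi).
have [sj jN] := representatives_admissible _ _ (r_in _ hj).
apply/eqP; rewrite -(nth_uniq [::] _ _ (uniq_signatures R)) ?size_map //.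
by rewrite !(nth_map (1, 0)%R) //; apply/eqP; exact: entails_signature.
Qed.
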